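(* Consider a two-way instance: at each step $t\in[T]$, independently across steps, at most one two-way surrogate type is realized, type $i\sim\{j,k\}$ (with $i\in I$ and $j\ne k$ agents) with probability $f^t_{i\sim\{j,k\}}$, and each realized item is allocated to the agent selected by the Two-Way SOCS for AdWords. For an agent $j$ with budget $B_j>0$ let $y_j=\sum_{t\in[T]}\sum_{i\in I}\sum_{k\ne j}\frac12 f^t_{i\sim\{j,k\}}\frac{b_{ij}}{B_j}$ and let $A_j$ be the sum of $b_{ij}$ over the items allocated to $j$. Then for every agent $j$, $$\mathbf{E}\Big[\Big(1-\frac{A_j}{B_j}\Big)^+\Big]\le e^{-y_j}\Big(\frac34+\frac14\cdot\frac{1+y_j/4}{e^{y_j/4}}\Big)^2.$$
   Context: Agents $j$ have budgets $B_j>0$ and bids $b_{ij}\ge0$ for items of type $i$, with $b_{ij}\le B_j$. Two-Way SOCS for AdWords (stateful rule): when an item with two-way surrogate type $i\sim\{j,k\}$ arrives at step $t$: pick $m\in\{j,k\}$ uniformly at random; if $b_{im}\ge\frac23B_m$, mark this step with $m$; if this is the second step marked with $m$, make the opposite selection w.r.t. $m$ to the one at the first step marked with $m$ (select $m$ iff $m$ was not selected there); otherwise select $j$ or $k$ uniformly at random. All random choices are independent. *)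

(* Defs.v *)
From HB Require Import structures.
From mathcomp Require Import all_boot all_order all_algebra.
From mathcomp Require Import reals.

Set Implicit Arguments.
Unset Strict Implicit.
Unset Printing Implicit Defensive.

Import Order.TTheory GRing.Theory Num.Theory.
Local Open Scope ring_scope.

Section TwoWaySOCS.

Variables (R : realType) (I J : finType).

(* The surrogate type i ~ {j,k} is the pair (i, [set j; k]); only sets of
   cardinality 2 are surrogate types, and the value of f on other sets is
   never used.

   The randomness consumed in one step: [None] if no item arrives, and
   [Some (i, e, m, s)] if an item of type i ~ e arrives, where m in e is the
   agent picked at random by the algorithm and s in e is the agent that an
   independent uniformly random selection would choose. *)
Definition outcome : finType := option (I * {set J} * J * J)%type.

Definition outcome_prob (f : I -> {set J} -> R) (o : outcome) : R :=
  match o with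
  | None => 1 - \sum_i \sum_(e : {set J} | #|e| == 2%N) f i e
  | Some (i, e, m, s) =>
      if [&& #|e| == 2%N, m \in e & s \in e] then f i e * 2^-1 * 2^-1 else 0
  end.

Definition expectation (T : nat) (f : 'I_T -> I -> {set J} -> R)
    (X : {ffun 'I_T -> outcome} -> R) : R :=
  \sum_(w : {ffun 'I_T -> outcome})
    (\prod_(t < T) outcome_prob (f t) (w t)) * X w.

Variables (B : J -> R) (b : I -> J -> R).

Definition large_bid (i : I) (m : J) : bool := 2 / 3 * B m <= b i m.

(* [marks s m] lists the steps marked with m so far, in chronological order;
   the entry of a step is [true] iff m was selected at that step.
   [allocated s] lists the pairs (item type, selected agent) so far. *)
Record state := State {
  marks : J -> seq bool;
  allocated : seq (I * J)
}.

Definition initial_state : state := State (fun=> [::]) [::].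

(* The agent of e = {m,k} other than m. *)
Definition other (e : {set J}) (m : J) : J := odflt m [pick k in e :\ m].

Definition select (st : state) (i : I) (e : {set J}) (m s : J) : J :=
  if large_bid i m then
    match marks st m with
    | [:: first_selected] => if first_selected then other e m else m
    | _ => s
    end
  else s.

Definition step (st : state) (o : outcome) : state :=
  match o with
  | None => st
  | Some (i, e, m, s) =>
      let a := select st i e m s in
      State
        (fun j => if large_bid i m && (j == m) then rcons (marks st j) (a == j)
                  else marks st j)
        (rcons (allocated st) (i, a))
  end.

Definition run (T : nat) (w : {ffun 'I_T -> outcome}) : state :=
  foldl step initial_state [seq w t | t <- enum 'I_T].

Definition spent (T : nat) (j : J) (w : {ffun 'I_T -> outcome}) : R :=
  \sum_(p <- allocated (run w) | p.2 == j) b p.1 j.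

Definition load (T : nat) (f : 'I_T -> I -> {set J} -> R) (j : J) : R :=
  \sum_(t < T) \sum_(i : I) \sum_(k : J | k != j)
    2^-1 * f t i [set j; k] * (b i j / B j).

End TwoWaySOCS.

(* Main.v *)
Require Import Defs.
From HB Require Import structures.
From mathcomp Require Import all_boot all_order all_algebra.
From mathcomp Require Import reals sequences exp.
From mathcomp Require Import topology normedtype derive.
From mathcomp Require Import ring lra.

(* Fix agent j and let A be the fraction of its budget that is spent.  Since
   [x |-> (1 - x)^+] is convex, two opposite selections are at least as good for
   j as two independent ones, so all correlations due to agents other than j may
   be dropped.  Call a bid large if it is at least 2/3 of the budget, and write
   [y] and [z] for the parts of the load due to large and to small bids.  Two
   large items exhaust the budget, so the state of the remaining process is the
   mark history of j, whether a large item was obtained, and the amount [s] spent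
   on small items.  A potential that dominates the expected drop at every step
   bounds the expectation.

   The potential [((1 - s)^+ + (1 - 3s/2)^+ z/2) e^(-3z/2)] for the small items,
   times a function of [y], shows that the expectation is at most [e^(-y-z)] times
   [(69/100 + 31/100 (1 + y/2) e^(-y/2)) (1 + z/2) e^(-z/2)], which suffices if
   [y <= 8].  If [y >= 8], the probability that no large item is obtained is
   negligible, and exactly one is obtained with little enough budget left for the
   bound [9/16 e^(-y-z)]. *)

Set Implicit Arguments.
Unset Strict Implicit.
Unset Printing Implicit Defensive.

Import Order.TTheory GRing.Theory Num.Theory.
Import numFieldNormedType.Exports.
Local Open Scope ring_scope.

(** * Scalar inequalities between polynomials and exponentials *)

Section ExponentialInequalities.

Variable R : realType.
Implicit Types u v w x y z : R.

Lemma ge0_of_derive (f f' : R -> R) x :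
  (forall t : R, is_derive t 1 f (f' t)) -> (forall t, 0 <= t -> 0 <= f' t) ->
  f 0 = 0 -> 0 <= x -> 0 <= f x.
Proof.
move=> df f'_ge0 f0 x0; rewrite -f0.
apply: (@ger0_derive1_ndecry R f 0) => //.
- move=> t; rewrite in_itv/= andbT => /ltW t0.
  by rewrite derive1E; have [_ ->] := df t; exact: f'_ge0.
- apply: continuous_subspaceT => s.
  apply: differentiable_continuous; apply/derivable1_diffP.
  by have [] := df s.
Qed.

Lemma expRN_mul1Dx_le1 x : (1 + x) * expR (- x) <= 1.
Proof.
rewrite expRN ler_pdivrMr ?expR_gt0// mul1r; exact: expR_ge1Dx.
Qed.

(** The Pade bound for [e^-w] with its denominator cleared; the derivative of the gap is half of
    [1 - (1 + w) e^-w]. *)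
Lemma expRN_pade w : 0 <= w -> 1 - w / 2 <= (1 + w / 2) * expR (- w).
Proof.
move=> w0; rewrite -subr_ge0.
pose f t : R := (1 + t / 2) * expR (- t) - (1 - t / 2).
pose f' t : R := 2^-1 * (1 - (1 + t) * expR (- t)).
apply: (@ge0_of_derive f f') => //.
- move=> t; rewrite /f /f'; apply: is_derive_eq.
  by rewrite /GRing.scale/=; field.
- by move=> t _; rewrite /f' mulr_ge0 ?invr_ge0 ?subr_ge0 ?expRN_mul1Dx_le1//.
- by rewrite /f oppr0 expR0; ring.
Qed.

Lemma expR_ge_quad v : 0 <= v -> 1 + v + v ^+ 2 / 2 <= expR v.
Proof.
move=> v0; rewrite -subr_ge0.
pose f t : R := expR t - (1 + t + t ^+ 2 / 2).
pose f' t : R := expR t - (1 + t).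
apply: (@ge0_of_derive f f') => //.
- move=> t; rewrite /f /f'; apply: is_derive_eq.
  by rewrite /GRing.scale/=; field.
- by move=> t _; rewrite /f' subr_ge0 expR_ge1Dx.
- by rewrite /f expR0; ring.
Qed.

(** The left side is the first-order part of the right side, so a linear change over one step
    becomes an exponential. The loss [d x (1 - k) / 2] is absorbed since [d <= c] and, by the Pade
    bound, [w (1 - k) / 3 <= k - 1 + w]. *)
Lemma damp_ge (c d x z : R) : 0 <= d <= c -> 0 <= x -> 0 <= z ->
  c * (1 - (3 / 2 * x + z)) + d * (x / 2) <=
  (c + d * (x / 2)) * expR (- (3 / 2 * x + z)).
Proof.
move=> /andP[d0 dc] x0 z0; set w := 3 / 2 * x + z; set k := expR (- w).
have w0 : 0 <= w by rewrite /w; lra.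
have k1 : 1 - w <= k by have := expR_ge1Dx (- w); rewrite -/k; lra.
have kpade : 1 - w / 2 <= (1 + w / 2) * k by exact: expRN_pade.
have kle1 : k <= 1 by rewrite /k expR_le1; lra.
have key : (w / 3) * (1 - k) <= k - 1 + w.
  rewrite -subr_ge0 -(@pmulr_rge0 _ (1 + w / 2)); last by lra.
  have -> : (1 + w / 2) * (k - 1 + w - w / 3 * (1 - k)) =
     ((1 + w / 2) * k - (1 - w / 2)) * (1 + w / 3) + w ^+ 2 / 6 by field.
  by rewrite addr_ge0 ?mulr_ge0 ?divr_ge0 ?sqr_ge0// ?subr_ge0//; lra.
have key2 : (x / 2) * (1 - k) <= (w / 3) * (1 - k).
  by apply: ler_wpM2r; rewrite ?subr_ge0// /w; lra.
have h1 : d * (k - 1 + w) <= c * (k - 1 + w) by apply: ler_wpM2r => //; lra.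
have h2 : d * ((x / 2) * (1 - k)) <= d * (k - 1 + w).
  by apply: ler_wpM2l => //; exact: le_trans key2 key.
lra.
Qed.

Lemma damp_le (c d x z : R) : 0 <= d <= c -> 0 <= x -> 0 <= z ->
  (c + d * (x / 2)) * expR (- (3 / 2 * x + z)) <= c.
Proof.
move=> /andP[d0 dc] x0 z0; set w := 3 / 2 * x + z.
apply: (@le_trans _ _ (c * ((1 + w) * expR (- w)))).
  rewrite [leRHS]mulrA; apply: ler_wpM2r; first exact: expR_ge0.
  have : d * (x / 2) <= c * (x / 2) by apply: ler_wpM2r => //; lra.
  have : c * (x / 2) <= c * w by apply: ler_wpM2l; rewrite /w; lra.
  lra.
by rewrite -[leRHS]mulr1; apply: ler_wpM2l; [lra|exact: expRN_mul1Dx_le1].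
Qed.

(** The equation [V' = e^-y - 3 V / 2], [V 0 = 1], of the phase [SelMark] is solved by
    [2 e^-y - e^(-3y/2)], which is not convex near 0. This is a convex supersolution. *)
Definition ter t : R := 2 * expR (- t) - (1 + t / 2) * expR (- t) ^+ 2.

Lemma ter_convex y x : 0 <= y -> 0 <= x ->
  ter y + x * ((3 / 2 + y) * expR (- y) ^+ 2 - 2 * expR (- y)) <= ter (y + x).
Proof.
move=> y0 x0; rewrite /ter opprD expRD.
set p := expR (- y); set k := expR (- x).
have p0 : 0 <= p by exact: expR_ge0.
have p1 : (1 + y) * p <= 1 by exact: expRN_mul1Dx_le1.
have kle1 : k <= 1 by rewrite /k expR_le1; lra.
have k0 : 0 <= k by exact: expR_ge0.
have kx : 1 - x <= k by have := expR_ge1Dx (- x); rewrite -/k; lra.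
have kpade : 1 - x / 2 <= (1 + x / 2) * k by exact: expRN_pade.
have k2pade : 1 - x <= (1 + x) * k ^+ 2.
  have x20 : 0 <= 2 * x by lra.
  have := expRN_pade x20.
  have -> : - (2 * x) = - x + - x by ring.
  by rewrite expRD -/k; lra.
(* The gap to the tangent is [2 p (k - 1 + x) - p^2 ((1 + y/2) a - d)]. *)
pose a := k ^+ 2 - 1 + 2 * x; pose d := x / 2 * (1 - k ^+ 2).
have da : 2 * d <= a by rewrite /a /d; lra.
have k21 : k ^+ 2 <= 1 by rewrite expr_le1.
have d0 : 0 <= d by rewrite /d mulr_ge0// ?subr_ge0//; lra.
have h1 : p * ((1 + y / 2) * a - d) <= a - d.
  have : p * ((1 + y / 2) * a - d) <= p * ((1 + y) * (a - d)).
    apply: ler_wpM2l => //.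
    have : y * (2 * d) <= y * a by exact: ler_wpM2l.
    lra.
  have : (1 + y) * p * (a - d) <= 1 * (a - d) by apply: ler_wpM2r => //; lra.
  lra.
have h2 : a - d <= 2 * (k - 1 + x).
  have : 0 <= (1 - k) * ((1 + x / 2) * k - (1 - x / 2)).
    by rewrite mulr_ge0 ?subr_ge0.
  rewrite /a /d; lra.
have : p * (p * ((1 + y / 2) * a - d)) <= p * (2 * (k - 1 + x)).
  by apply: ler_wpM2l => //; exact: le_trans h1 h2.
rewrite /a /d; lra.
Qed.

Lemma ter_le y x : 0 <= y -> 0 <= x ->
  ter (y + x) <= ter y.
Proof.
move=> y0 x0; rewrite /ter opprD expRD.
set p := expR (- y); set k := expR (- x).
have p0 : 0 <= p by exact: expR_ge0.
have p1 : (1 + y) * p <= 1 by exact: expRN_mul1Dx_le1.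
have kle1 : k <= 1 by rewrite /k expR_le1; lra.
have k0 : 0 <= k by exact: expR_ge0.
have k21 : k ^+ 2 <= 1 by rewrite expr_le1.
have h0 : 0 <= x / 2 * (p * k) ^+ 2 by rewrite mulr_ge0 ?sqr_ge0//; lra.
have h3 : 0 <= p * y by exact: mulr_ge0.
have h1 : (1 + y / 2) * p <= 1 by lra.
have h2 : 0 <= p * (1 - k) * (2 - (1 + y / 2) * p * (1 + k)).
  rewrite mulr_ge0 ?mulr_ge0 ?subr_ge0//.
  have : (1 + y / 2) * p * (1 + k) <= 1 * (1 + k) by apply: ler_wpM2r => //; lra.
  lra.
lra.
Qed.

(* Multiplied by [e^u / 2], the difference of the two sides has derivative
   [e^u / 16 - 7/400 - u e^-u / 4]. *)
Lemma zero_state_rate u : 0 <= u ->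
  (625 / 1000 + 35 / 1000 * u) * expR (- u) <=
  125 / 1000 + (1 / 2 + u / 2) * expR (- u) ^+ 2.
Proof.
move=> u0; set k := expR (- u).
pose f t : R := 1 / 16 * expR t - 1 / 16 - 7 / 400 * t - 1 / 4
   + 1 / 4 * ((1 + t) * expR (- t)).
pose f' t : R := 1 / 16 * expR t - 7 / 400 - 1 / 4 * (t * expR (- t)).
have f_ge0 : 0 <= f u.
  apply: (@ge0_of_derive f f') => //.
  - move=> t; rewrite /f /f'; apply: is_derive_eq.
    by rewrite /GRing.scale/=; field.
  - move=> t t0; rewrite /f'.
    have e0 : 0 < expR t by exact: expR_gt0.
    have eq := expR_ge_quad t0.
    set p := 1 + t + t ^+ 2 / 2 in eq.
    have h1 : t * expR (- t) <= t / p.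
      apply: ler_wpM2l => //; rewrite expRN lef_pV2// posrE.
      by rewrite /p; nra.
    have p0 : 0 < p by rewrite /p; nra.
    have h2 : t / p <= 4 * (1 / 16 * p - 7 / 400).
      rewrite ler_pdivrMr//.
      have q1 : 0 <= (t - 1 / 2) ^+ 2 by exact: sqr_ge0.
      have q2 : 0 <= t * (t - 1 / 2) ^+ 2 by rewrite mulr_ge0.
      have q3 : 0 <= (t ^+ 2) ^+ 2 by exact: sqr_ge0.
      rewrite /p; nra.
    lra.
  - by rewrite /f oppr0 expR0; field.
have k0 : 0 <= k by exact: expR_ge0.
have kk : k * expR u = 1 by rewrite mulrC /k expRxMexpNx_1.
have : 0 <= 2 * k * f u by rewrite mulr_ge0 ?mulr_ge0.
rewrite /f -/k.
have -> : 2 * k * (1 / 16 * expR u - 1 / 16 - 7 / 400 * u - 1 / 4 + 1 / 4 * ((1 + u) * k))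
   = (k * expR u) / 8 - k / 8 - 35 / 1000 * u * k - k / 2 + (1 / 2 + u / 2) * k ^+ 2 by field.
rewrite kk; lra.
Qed.

Lemma expRN2_ge : 133 / 1000 <= expR (- 2) :> R.
Proof.
have h : 7 / 9 <= expR (- (1 / 4)) :> R.
  have q0 : 0 <= 1 / 4 :> R by lra.
  have := expRN_pade q0; lra.
have -> : - 2 = - (1 / 4) * 8%:R :> R by field.
rewrite expRM_natr.
apply: (@le_trans _ _ ((7 / 9) ^+ 8)); first by lra.
by apply: lerXn2r; rewrite // nnegrE ?expR_ge0//; lra.
Qed.

Lemma expRN4_le : expR (- 4) <= 1 / 50 :> R.
Proof.
have h : 32 / 25 <= expR (1 / 4) :> R.
  have q0 : 0 <= 1 / 4 :> R by lra.
  have := expR_ge_quad q0; lra.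
rewrite expRN -div1r ler_pM2l// lef_pV2 ?posrE ?expR_gt0//.
have -> : 4 = (1 / 4) * 16%:R :> R by field.
rewrite expRM_natr.
apply: (@le_trans _ _ ((32 / 25) ^+ 16)); first by lra.
by apply: lerXn2r; rewrite // nnegrE ?expR_ge0//; lra.
Qed.

Lemma gamma_decr u v : 0 <= u -> 0 <= v ->
  (1 + u + v) * expR (- (u + v)) <= (1 + u) * expR (- u).
Proof.
move=> u0 v0; rewrite opprD expRD.
have h := expRN_mul1Dx_le1 v.
have p0 := expR_ge0 (- u); have k0 := expR_ge0 (- v).
have : (1 + u + v) * expR (- v) <= 1 + u.
  have : (1 + u + v) * expR (- v) <= (1 + u) * ((1 + v) * expR (- v)).
    rewrite mulrA; apply: ler_wpM2r => //.
    by have : 0 <= u * v; [exact: mulr_ge0|lra].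
  have : (1 + u) * ((1 + v) * expR (- v)) <= (1 + u) * 1 by apply: ler_wpM2l => //; lra.
  lra.
by move=> /(ler_wpM2r p0); lra.
Qed.

Lemma xexpN_decr u v : 1 <= u -> 0 <= v ->
  (u + v) * expR (- (u + v)) <= u * expR (- u).
Proof.
move=> u0 v0; rewrite opprD expRD.
have h := expRN_mul1Dx_le1 v.
have p0 := expR_ge0 (- u); have k0 := expR_ge0 (- v).
have : (u + v) * expR (- v) <= u.
  have : (u + v) * expR (- v) <= u * ((1 + v) * expR (- v)).
    rewrite mulrA; apply: ler_wpM2r => //.
    by have : v <= u * v; [rewrite ler_peMl|lra].
  have : u * ((1 + v) * expR (- v)) <= u * 1 by apply: ler_wpM2l => //; lra.
  lra.
by move=> /(ler_wpM2r p0); lra.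
Qed.

(* The subtracted square puts the factor just below the bound
   [(3 + (1 + u) e^-u) / 4] needed at [v = 0], which pays for the other [v]. *)
Lemma gamma_mix u v : 0 <= u <= 2 -> 0 <= v ->
  2 * ((3 + (1 + u) * expR (- u)) / 4 - (u * expR (- u)) ^+ 2 / 44) *
    (1 + (1 + 2 * v) * expR (- (2 * v))) <=
  3 + (1 + u + v) * expR (- (u + v)).
Proof.
move=> /andP[u0 u2] v0; set p := expR (- u); set H := _ - _ / 44.
have p0 : 0 <= p by exact: expR_ge0.
have gle1 : (1 + u) * p <= 1 by exact: expRN_mul1Dx_le1.
set V := expR v.
have V0 : 0 < V by exact: expR_gt0.
have hV : 1 + v + v ^+ 2 / 2 <= V by exact: expR_ge_quad.
have hV2 : 1 + 2 * v + 2 * v ^+ 2 <= V ^+ 2.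
  have v20 : 0 <= 2 * v by lra.
  have := expR_ge_quad v20.
  have -> : 2 * v = v + v by ring.
  by rewrite expRD -/V; lra.
have -> : expR (- (2 * v)) = V ^- 2.
  have -> : - (2 * v) = - v + - v by ring.
  by rewrite expRD expRN -/V -invfM -expr2.
have -> : expR (- (u + v)) = p / V by rewrite opprD expRD [expR (- v)]expRN.
have Vn0 : V != 0 by exact: lt0r_neq0.
rewrite -(@ler_pM2r _ (V ^+ 2)) ?exprn_gt0//.
have -> : 2 * H * (1 + (1 + 2 * v) / V ^+ 2) * V ^+ 2 =
          2 * H * V ^+ 2 + 2 * H * (1 + 2 * v) by field.
have -> : (3 + (1 + u + v) * (p / V)) * V ^+ 2 =
          3 * V ^+ 2 + ((1 + u) * p + p * v) * V by field.
set r := (u * p) ^+ 2 in H *.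
have r0 : 0 <= r by exact: sqr_ge0.
have pu0 : 0 <= p * u by exact: mulr_ge0.
have pv0 : 0 <= p * v by exact: mulr_ge0.
have c0 : 0 <= 3 - 2 * H by rewrite /H; lra.
have h1 : (3 - 2 * H) * (1 + 2 * v + 2 * v ^+ 2) <= (3 - 2 * H) * V ^+ 2.
  exact: ler_wpM2l.
have h2 : ((1 + u) * p + p * v) * (1 + v + v ^+ 2 / 2) <= ((1 + u) * p + p * v) * V.
  by apply: ler_wpM2l => //; lra.
(* Here [u <= 2] is used: [(1 + u + u^2/2) - 5 (u - 1)] equals [(2 - u) (6 - u) / 2]. *)
have pu1 : p * (u - 1) <= 1 / 5.
  have q : (1 + u + u ^+ 2 / 2) * p <= 1.
    by rewrite /p expRN ler_pdivrMr ?expR_gt0// mul1r expR_ge_quad.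
  have s : 0 <= (2 - u) * (6 - u) * p by rewrite !mulr_ge0 //; lra.
  lra.
have p3 : 0 <= p * v ^+ 3 by rewrite mulr_ge0 ?exprn_ge0.
have h3 : 0 <= r * v by exact: mulr_ge0.
have h4 : 0 <= r * v ^+ 2 by rewrite mulr_ge0 ?sqr_ge0.
have h5 : 0 <= (1 / 5 - p * (u - 1)) * v ^+ 2.
  by rewrite mulr_ge0 ?sqr_ge0// subr_ge0.
(* [r / 11 - (u p) v + 29/10 v^2] has negative discriminant *)
have h6 : 0 <= (u * p / 4 - 2 * v) ^+ 2 by exact: sqr_ge0.
have h7 : 0 <= (u * p * (2 / 11) - v) ^+ 2 by exact: sqr_ge0.
have h8 : 0 <= v ^+ 2 by exact: sqr_ge0.
rewrite /H in h1 *; rewrite /r in h1 r0 h3 h4 *; lra.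
Qed.

Lemma gamma_bound u : 0 <= u <= 2 ->
  (69 / 100 + 31 / 100 * ((1 + 2 * u) * expR (- (2 * u))) <=
  ((3 + (1 + u) * expR (- u)) / 4 - (u * expR (- u)) ^+ 2 / 44) ^+ 2).
Proof.
move=> /andP[u0 u2]; set p := expR (- u).
have p0 : 0 <= p by exact: expR_ge0.
have -> : expR (- (2 * u)) = p ^+ 2.
  have -> : - (2 * u) = - u + - u by ring.
  by rewrite expRD -expr2.
set g := (1 + u) * p; set r := (u * p) ^+ 2.
have gle1 : g <= 1 by exact: expRN_mul1Dx_le1.
have g0 : 0 <= g by rewrite mulr_ge0//; lra.
have -> : (1 + 2 * u) * p ^+ 2 = g ^+ 2 - r by rewrite /g /r; ring.
have r0 : 0 <= r by exact: sqr_ge0.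
(* The first product is [((3 + g)/4)^2 - 69/100 - 31 g^2/100], and [r] keeps at least the
   coefficient [31/100 - 1/22]. For [u <= 1] the product is nonnegative; beyond that [r]
   compensates. *)
suff : 0 <= (1 - g) * (2475 / 10000 * g - 1275 / 10000) + 2645 / 10000 * r.
  have : 0 <= (1 - g) * r by rewrite mulr_ge0// subr_ge0.
  have : 0 <= r ^+ 2 by exact: sqr_ge0.
  nra.
have [u1|u1] := lerP u 1.
  have hg : 2 / 3 <= g.
    have v0 : 0 <= 1 - u by lra.
    have := gamma_decr u0 v0.
    have -> : u + (1 - u) = 1 by ring.
    rewrite -/p -/g.
    have h01 : 0 <= 1 :> R by [].
    have := expRN_pade h01; lra.
  by rewrite addr_ge0 ?mulr_ge0//; lra.
have e2 := expRN2_ge.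
have hg : 399 / 1000 <= g.
  have v0 : 0 <= 2 - u by lra.
  have := gamma_decr u0 v0.
  have -> : u + (2 - u) = 2 by ring.
  rewrite -/p -/g; lra.
have hup : 266 / 1000 <= u * p.
  have v0 : 0 <= 2 - u by lra.
  have := xexpN_decr (ltW u1) v0.
  have -> : u + (2 - u) = 2 by ring.
  rewrite -/p; lra.
have hr : 707 / 10000 <= r.
  have : (266 / 1000) ^+ 2 <= r by apply: lerXn2r; rewrite // nnegrE; lra.
  lra.
have : 0 <= (1 - g) * (g - 399 / 1000) by rewrite mulr_ge0//; lra.
nra.
Qed.

(** The two previous bounds at [u = y/4] and [v = z/4]. The factor [t] of the small load is brought
    under the square by [t <= ((1 + t)/2)^2]. *)
Lemma moderate_large_load y z : 0 <= y <= 8 -> 0 <= z ->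
  (69 / 100 + 31 / 100 * ((1 + y / 2) * expR (- (y / 2)))) *
    ((1 + z / 2) * expR (- (z / 2))) <=
  (3 / 4 + 1 / 4 * ((1 + (y + z) / 4) / expR ((y + z) / 4))) ^+ 2.
Proof.
move=> y08 z0.
have u02 : 0 <= y / 4 <= 2 by lra.
have v0 : 0 <= z / 4 by lra.
have h1 := gamma_bound u02; have h2 := gamma_mix u02 v0.
rewrite /= -expRN.
have ey : y / 2 = 2 * (y / 4) by field.
have ez : z / 2 = 2 * (z / 4) by field.
have eyz : (y + z) / 4 = y / 4 + z / 4 by field.
rewrite ey ez eyz addrA.
move: h1 h2.
set t := (1 + 2 * (z / 4)) * _; set H := _ - _ / 44.
set G := _ + 31 / 100 * _; set G' := (1 + y / 4 + z / 4) * _ => GH Hm.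
have t0 : 0 <= t by rewrite /t mulr_ge0 ?expR_ge0//; lra.
have G0 : 0 <= G by rewrite /G addr_ge0 ?mulr_ge0 ?expR_ge0//; lra.
have H0 : 0 <= H.
  have p0 := expR_ge0 (- (y / 4)).
  have p1 := expRN_mul1Dx_le1 (y / 4).
  have : (y / 4 * expR (- (y / 4))) ^+ 2 <= 1.
    rewrite expr_le1//; first lra.
    by rewrite mulr_ge0//; lra.
  have : 0 <= (1 + y / 4) * expR (- (y / 4)) by rewrite mulr_ge0//; lra.
  rewrite /H; lra.
have ht : t <= ((1 + t) / 2) ^+ 2.
  have : 0 <= (1 - t) ^+ 2 by exact: sqr_ge0.
  lra.
apply: (@le_trans _ _ (H ^+ 2 * ((1 + t) / 2) ^+ 2)); first exact: ler_pM.
rewrite -exprMn; apply: lerXn2r; rewrite ?nnegrE.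
- by rewrite mulr_ge0//; lra.
- by have : 0 <= H * (1 + t); [rewrite mulr_ge0//; lra|lra].
- lra.
Qed.

End ExponentialInequalities.

(** * Sums over the outcomes of one step *)

Section OutcomeSums.

Variables (R : realType) (I J : finType).
Implicit Types (g : I -> {set J} -> R) (gs : seq (I -> {set J} -> R)).

Definition feasible g : Prop :=
  (forall i (e : {set J}), #|e| == 2%N -> 0 <= g i e) /\
  \sum_i \sum_(e : {set J} | #|e| == 2%N) g i e <= 1.

Lemma sum_option (S : finType) (F : option S -> R) :
  \sum_o F o = F None + \sum_x F (Some x).
Proof.
rewrite (bigD1 None)//=; congr (_ + _).
rewrite [LHS](reindex_omap Some id) //=; last by case.
by apply: eq_bigl => x; rewrite eqxx.
Qed.

Lemma sum_pair (S S' : finType) (F : S * S' -> R) :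
  \sum_p F p = \sum_x \sum_y F (x, y).
Proof. by rewrite pair_bigA; apply: eq_bigr => -[]. Qed.

Lemma sum_outcome g (F : outcome I J -> R) :
  \sum_o outcome_prob g o * F o =
  (1 - \sum_i \sum_(e : {set J} | #|e| == 2%N) g i e) * F None +
  \sum_i \sum_(e : {set J} | #|e| == 2%N)
    g i e / 4 * \sum_(m in e) \sum_(s in e) F (Some (i, e, m, s)).
Proof.
rewrite sum_option; congr (_ + _).
rewrite !sum_pair.
apply: eq_bigr => i _; rewrite [RHS]big_mkcond/=; apply: eq_bigr => e _.
case: ifPn => e2; last first.
  by rewrite big1// => m _; rewrite big1// => s _; rewrite mul0r.
rewrite mulr_sumr [RHS]big_mkcond/=; apply: eq_bigr => m _.
case: ifPn => me; last by rewrite big1// => s _; rewrite mul0r.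
rewrite mulr_sumr [RHS]big_mkcond/=; apply: eq_bigr => s _.
by case: ifPn => se; [congr (_ * _); field|rewrite mul0r].
Qed.

(** Given the type and [m], both values of [s] are equally likely, so only their sums need be
    compared; in the exchange arguments the termwise inequality can fail. *)
Lemma sum_outcome_le g (F G : outcome I J -> R) : feasible g ->
  F None <= G None ->
  (forall i m l, m != l ->
     F (Some (i, [set m; l], m, m)) + F (Some (i, [set m; l], m, l)) <=
     G (Some (i, [set m; l], m, m)) + G (Some (i, [set m; l], m, l))) ->
  \sum_o outcome_prob g o * F o <= \sum_o outcome_prob g o * G o.
Proof.
move=> [g0 g1] FG0 FG; rewrite !sum_outcome; apply: lerD.
  by apply: ler_wpM2l => //; rewrite subr_ge0.
apply: ler_sum => i _; apply: ler_sum => e e2.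
apply: ler_wpM2l; first by rewrite divr_ge0 ?g0.
apply: ler_sum => m me.
have /cards2P[x [y [xy eE]]] : #|e| == 2%N by [].
have [l ml ->] : exists2 l, m != l & e = [set m; l].
  move: me; rewrite eE !inE => /orP[/eqP->|/eqP->]; first by exists y.
  by exists x; rewrite 1?eq_sym// setUC.
by rewrite !big_setU1 ?inE//= !big_set1; exact: FG.
Qed.

Lemma other_pair (m l : J) : m != l -> other [set m; l] m = l.
Proof.
move=> ml; rewrite /other; case: pickP => [k|/(_ l)].
  by rewrite !inE => /andP[km /orP[/eqP kE|/eqP//]]; rewrite kE eqxx in km.
by rewrite !inE eqxx eq_sym ml orbT.
Qed.

Definition feasibles gs : Prop := foldr (fun g P => feasible g /\ P) True gs.

End OutcomeSums.

(** * Removing the correlations due to agents other than [j] *)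

Section Decorrelation.

Variables (R : realType) (I J : finType) (B : J -> R) (b : I -> J -> R) (j : J).
Hypothesis B_gt0 : forall j, 0 < B j.
Hypothesis b_ge0 : forall i j, 0 <= b i j.
Implicit Types (g : I -> {set J} -> R) (gs : seq (I -> {set J} -> R)).
Implicit Types (K : {set J}) (mk : J -> seq bool) (A a : R).

Definition rel_bid i : R := b i j / B j.

Definition gain i (a : J) : R := if a == j then rel_bid i else 0.

(* The selection rule in which only the agents of [K] correlate their first
   two marked steps. *)
Definition selectK K mk i (e : {set J}) (m s : J) : J :=
  if large_bid B b i m && (m \in K) then
    match mk m with
    | [:: first_selected] => if first_selected then other e m else m
    | _ => s
    end
  else s.

Definition mark mk i (m a : J) : J -> seq bool :=
  fun l => if large_bid B b i m && (l == m) then rcons (mk l) (a == l)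
           else mk l.

(** Backward recursion for the expected unspent fraction of [j], from mark histories [mk] and spent
    fraction [A]. The algorithm itself is [K = [set: J]]. *)
Fixpoint value K gs mk A : R :=
  match gs with
  | [::] => Num.max (1 - A) 0
  | g :: gs' =>
    \sum_(o : outcome I J) outcome_prob g o *
      match o with
      | None => value K gs' mk A
      | Some (i, e, m, s) =>
          let a := selectK K mk i e m s in
          value K gs' (mark mk i m a) (A + gain i a)
      end
  end.

Lemma rel_bid_ge0 i : 0 <= rel_bid i.
Proof. by rewrite /rel_bid divr_ge0// ltW. Qed.

Lemma gain_ge0 i (s : J) : 0 <= gain i s.
Proof. by rewrite /gain; case: ifP => // _; exact: rel_bid_ge0. Qed.

Lemma value_spent_out K gs mk A : feasibles gs -> 1 <= A -> value K gs mk A = 0.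
Proof.
move=> + A1; have : 1 <= A by [].
elim: gs mk A {A1} => [|g gs IH] mk A /= A1; first by rewrite max_r// subr_le0.
move=> [fg fgs]; rewrite big1// => -[[[[i e] m] s]|] _; rewrite IH ?mulr0//.
by rewrite (le_trans A1)// lerDl gain_ge0.
Qed.

Lemma eq_value K gs mk mk' A : {in K, mk =1 mk'} ->
  value K gs mk A = value K gs mk' A.
Proof.
elim: gs mk mk' A => [//|g gs IH] mk mk' A eq_mk /=.
apply: eq_bigr => -[[[[i e] m] s]|] _; congr (_ * _); last exact: IH.
have -> : selectK K mk i e m s = selectK K mk' i e m s.
  by rewrite /selectK; case: ifP => // /andP[_ /eq_mk ->].
by apply: IH => l lK; rewrite /mark eq_mk.
Qed.

(** Selections and marks do not depend on [A], so the convexity of [(1 - A)^+] passes through every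
    step. *)
Lemma value_convex K gs mk A a a' : feasibles gs -> 0 <= a -> 0 <= a' ->
  value K gs mk (A + a) + value K gs mk (A + a') <=
  value K gs mk A + value K gs mk (A + a + a').
Proof.
move=> + a0 a'0; elim: gs mk A => [|g gs IH] mk A /=.
  by move=> _; rewrite /Order.max; do 4 case: ltP => ?; lra.
move=> [fg fgs]; rewrite -!big_split/=.
under eq_bigr do rewrite -mulrDr; under [leRHS]eq_bigr do rewrite -mulrDr.
apply: sum_outcome_le => //; first exact: IH.
move=> i m l ml; apply: lerD.
  by rewrite !(addrAC _ _ (gain _ _)); exact: IH.
by rewrite !(addrAC _ _ (gain _ _)); exact: IH.
Qed.

Lemma value_twice_marked K gs k mk A : (1 < size (mk k))%N ->
  value K gs mk A = value (K :\ k) gs mk A.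
Proof.
elim: gs mk A => [//|g gs IH] mk A mk2 /=.
apply: eq_bigr => -[[[[i e] m] s]|] _; congr (_ * _); last exact: IH.
have <- : selectK K mk i e m s = selectK (K :\ k) mk i e m s.
  rewrite /selectK !inE; have [->|//] := eqVneq m k.
  by rewrite !andbF; case: ifP => //; case: (mk k) mk2 => [|? []].
by apply: IH; rewrite /mark; case: ifP => // _; rewrite size_rcons ltnW.
Qed.

Lemma selectK_other K mk mk' k i e m s :
  ~~ (large_bid B b i m && (m == k)) -> (forall l, l != k -> mk l = mk' l) ->
  selectK K mk i e m s = selectK (K :\ k) mk' i e m s.
Proof.
rewrite /selectK !inE => + eq_mk; have [->|mk0] := eqVneq m k.
  by rewrite andbT => /negbTE->.
by rewrite eq_mk.
Qed.

Lemma mark_other mk k i m (s : J) : ~~ (large_bid B b i m && (m == k)) ->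
  mark mk i m s k = mk k.
Proof. by rewrite /mark eq_sym => /negbTE->. Qed.

(** The two histories are the equally likely results of the first mark; in [mkF] the opponent of [k]
    was selected, and [a] is what [j] gained. Opposite selections at the second mark put the gains
    [a] and [gain i l] on different histories, while independent ones may put both on the same one,
    which is no better by convexity. The histories are summed because the bound can fail for [mkF]
    alone. *)
Lemma value_marked_once K gs k mkT mkF A a : feasibles gs -> k != j -> 0 <= a ->
  mkT k = [:: true] -> mkF k = [:: false] ->
  (forall l, l != k -> mkT l = mkF l) ->
  value K gs mkT A + value K gs mkF (A + a) <=
  value (K :\ k) gs mkT A + value (K :\ k) gs mkF (A + a).
Proof.
move=> + kj a0; elim: gs mkT mkF A => [//|g gs IH] mkT mkF A /= [fg fgs] hT hF eq_mk.
have [kK|kK] := boolP (k \in K); last first.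
  suff -> : K :\ k = K by [].
  by apply/setDidPl; rewrite disjoint_sym disjoints1.
rewrite -!big_split/=.
under eq_bigr do rewrite -mulrDr; under [leRHS]eq_bigr do rewrite -mulrDr.
apply: sum_outcome_le => //; first exact: IH.
move=> i m l ml.
have [mk_k|mk_k] := boolP (large_bid B b i m && (m == k)); last first.
  have eq_mk' l' : l' != k -> mkF l' = mkT l' by move=> /eq_mk.
  rewrite -!(@selectK_other K mkT mkT k)// -!(@selectK_other K mkF mkF k)//.
  rewrite !(@selectK_other K mkF mkT k)// !(@selectK_other K mkT mkT k)//.
  by apply: lerD; rewrite (addrAC _ a); apply: IH; rewrite ?mark_other// => l' l'k;
    rewrite /mark eq_mk.
move: mk_k => /andP[big /eqP mk_k]; subst m.
have selT s : selectK K mkT i [set k; l] k s = l.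
  by rewrite /selectK big kK/= hT other_pair.
have selF s : selectK K mkF i [set k; l] k s = k.
  by rewrite /selectK big kK/= hF.
have selN mk s : selectK (K :\ k) mk i [set k; l] k s = s.
  by rewrite /selectK !inE eqxx andbF.
rewrite !selT !selF !selN.
have gk : gain i k = 0 by rewrite /gain (negbTE kj).
rewrite gk !addr0.
(* After its second mark [k] no longer correlates, and both histories agree elsewhere, so only the
   spent fraction still differs. *)
have tw x mk c : (mk = mkT \/ mk = mkF) ->
    value K gs (mark mk i k c) x = value (K :\ k) gs mkT x.
  move=> mkE; rewrite (@value_twice_marked _ _ k); last first.
    by rewrite /mark big eqxx size_rcons; case: mkE => ->; rewrite ?hT ?hF.
  apply: eq_value => l'; rewrite !inE => /andP[l'k _].
  by rewrite /mark (negbTE l'k) andbF; case: mkE => -> //; rewrite eq_mk.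
have tw' x mk c : (mk = mkT \/ mk = mkF) ->
    value (K :\ k) gs (mark mk i k c) x = value (K :\ k) gs mkT x.
  move=> mkE; apply: eq_value => l'; rewrite !inE => /andP[l'k _].
  by rewrite /mark (negbTE l'k) andbF; case: mkE => -> //; rewrite eq_mk.
rewrite !tw; try by [left|right]; rewrite !tw'; try by [left|right].
have := value_convex (K :\ k) mkT A fgs a0 (gain_ge0 i l).
lra.
Qed.

(** The first selection marked with [k] is a fair coin under both rules; its results are the two
    histories of [value_marked_once]. *)
Lemma value_unmarked K gs k mk A : feasibles gs -> k != j -> mk k = [::] ->
  value K gs mk A <= value (K :\ k) gs mk A.
Proof.
move=> + kj; elim: gs mk A => [//|g gs IH] mk A /= [fg fgs] mk0.
apply: sum_outcome_le => //; first exact: IH.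
move=> i m l ml.
have [mk_k|mk_k] := boolP (large_bid B b i m && (m == k)); last first.
  rewrite -!(@selectK_other K mk mk k)//.
  by apply: lerD; apply: IH => //; rewrite mark_other.
move: mk_k => /andP[big /eqP mk_k]; subst m.
have selN K' s : selectK K' mk i [set k; l] k s = s.
  by rewrite /selectK mk0; case: ifP.
rewrite !selN.
have gk : gain i k = 0 by rewrite /gain (negbTE kj).
rewrite gk addr0.
apply: value_marked_once => //; rewrite ?gain_ge0//.
- by rewrite /mark big eqxx mk0.
- by rewrite /mark big eqxx mk0 /= eq_sym (negbTE ml).
- by move=> l' l'k; rewrite /mark (negbTE l'k) andbF.
Qed.

Lemma value_decorrelate gs A : feasibles gs ->
  value [set: J] gs (fun=> [::]) A <= value [set j] gs (fun=> [::]) A.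
Proof.
move=> fgs.
suff H (s : seq J) : j \notin s ->
    value [set: J] gs (fun=> [::]) A <= value [set l | l \notin s] gs (fun=> [::]) A.
  rewrite (le_trans (H (enum (~: [set j])) _)) ?mem_enum ?inE ?eqxx//.
  suff -> : [set l | l \notin enum (~: [set j])] = [set j] by [].
  by apply/setP => l; rewrite !inE mem_enum !inE negbK.
elim: s => [_|k s IH].
  suff -> : [set l : J | l \notin [::]] = [set: J] by [].
  by apply/setP => l; rewrite !inE.
rewrite inE negb_or => /andP[jk js]; rewrite (le_trans (IH js))//.
suff -> : [set l | l \notin k :: s] = [set l | l \notin s] :\ k.
  by apply: value_unmarked; rewrite // eq_sym.
by apply/setP => l; rewrite !inE negb_or.
Qed.

End Decorrelation.

(** * The expectation as an iterated sum over the steps *)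

Section ExpectationAsValue.

Variables (R : realType).

Fixpoint esum (O : finType) (ps : seq (O -> R)) (G : seq O -> R) : R :=
  match ps with
  | [::] => G [::]
  | p :: ps' => \sum_o p o * esum ps' (fun l => G (o :: l))
  end.

Lemma sum_ffun_esum (O : finType) T (p : 'I_T -> O -> R) (G : seq O -> R) :
  \sum_(w : {ffun 'I_T -> O})
    (\prod_(t < T) p t (w t)) * G [seq w t | t <- enum 'I_T] =
  esum [seq p t | t <- enum 'I_T] G.
Proof.
elim: T p G => [|T IH] p G.
  have -> : enum 'I_0 = [::] by apply: size0nil; rewrite size_enum_ord.
  rewrite /=; under eq_bigr do rewrite big_ord0 mul1r.
  by rewrite sumr_const card_ffun card_ord expn0 mulr1n.
rewrite enum_ordSl /= -map_comp.
pose cons_ffun (x : O * {ffun 'I_T -> O}) : {ffun 'I_T.+1 -> O} :=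
  [ffun t => if unlift ord0 t is Some t' then x.2 t' else x.1].
have cons0 x : cons_ffun x ord0 = x.1 by rewrite ffunE unlift_none.
have consS x t : cons_ffun x (lift ord0 t) = x.2 t by rewrite ffunE liftK.
rewrite (reindex cons_ffun)/=; last first.
  exists (fun w => (w ord0, [ffun t => w (lift ord0 t)])).
    move=> [o w] _; rewrite cons0; congr (_, _).
    by apply/ffunP => t; rewrite ffunE consS.
  move=> w _; apply/ffunP => t; rewrite ffunE; case: unliftP => [t' ->|->//].
  by rewrite /= ffunE.
rewrite (@sum_pair R); apply: eq_bigr => o _.
rewrite -IH mulr_sumr; apply: eq_bigr => w _.
rewrite big_ord_recl cons0 mulrA /=; congr (_ * _ * G (_ :: _)).
  by apply: eq_bigr => t _; rewrite consS.
by rewrite -map_comp; apply: eq_map => t /=; rewrite consS.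
Qed.

Variables (I J : finType) (B : J -> R) (b : I -> J -> R) (j : J).

Lemma esum_value (gs : seq (I -> {set J} -> R)) (st : state I J) :
  esum [seq outcome_prob g | g <- gs]
    (fun l => Num.max
      (1 - (\sum_(p <- allocated (foldl (step B b) st l) | p.2 == j) b p.1 j)
           / B j) 0) =
  value B b j [set: J] gs (marks st)
    ((\sum_(p <- allocated st | p.2 == j) b p.1 j) / B j).
Proof.
elim: gs st => [//|g gs IH] st /=.
apply: eq_bigr => -[[[[i e] m] s]|] _; congr (_ * _); rewrite IH//=.
rewrite -/(mark B b (marks st) i m _).
have -> : select B b st i e m s = selectK B b [set: J] (marks st) i e m s.
  by rewrite /select /selectK inE andbT.
apply: (congr1 (value B b j _ gs _)).
rewrite -cats1 big_cat big_cons big_nil /= /gain /rel_bid.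
by case: eqP => _; rewrite ?addr0 ?mulrDl.
Qed.

Lemma expectation_value T (f : 'I_T -> I -> {set J} -> R) :
  expectation f (fun w => Num.max (1 - spent B b j w / B j) 0) =
  value B b j [set: J] [seq f t | t <- enum 'I_T] (fun=> [::]) 0.
Proof.
rewrite /expectation /spent /run.
rewrite (sum_ffun_esum (fun t => outcome_prob (f t)) (fun l => Num.max
  (1 - (\sum_(p <- allocated (foldl (step B b) (initial_state I J) l) | p.2 == j)
     b p.1 j) / B j) 0)).
by rewrite (map_comp (@outcome_prob R I J) f) esum_value /= big_nil mul0r.
Qed.

End ExpectationAsValue.

(** * The process as seen by agent [j] *)

Section SingleAgent.

Variables (R : realType) (I J : finType) (B : J -> R) (b : I -> J -> R) (j : J).
Hypothesis B_gt0 : forall j, 0 < B j.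
Hypothesis b_ge0 : forall i j, 0 <= b i j.
Hypothesis b_leB : forall i j, b i j <= B j.
Implicit Types (g : I -> {set J} -> R) (gs : seq (I -> {set J} -> R)).
Implicit Types (l : seq bool) (A s c : R).

Local Notation bid := (rel_bid B b j).
Local Notation large i := (large_bid B b i j).

Definition rate g i : R := \sum_(e : {set J} | (#|e| == 2%N) && (j \in e)) g i e.

Definition valj gs l A : R := value B b j [set j] gs (fun=> l) A.

(** The sum over [s] on a step marked with [j]. After exactly one mark the selection does not depend
    on [s], whence the factor 2. *)
Definition marked_sum gs l i A : R :=
  match l with
  | [:: x] => 2 * valj gs [:: x; ~~ x] (A + if x then 0 else bid i)
  | _ => valj gs (rcons l true) (A + bid i) + valj gs (rcons l false) A
  end.

Lemma rel_bid_le1 i : bid i <= 1.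
Proof. by rewrite /rel_bid ler_pdivrMr// mul1r. Qed.

Lemma largeE i : large i = (2 / 3 <= bid i).
Proof. by rewrite /large_bid ler_pdivlMr. Qed.

Lemma value_valj gs mk A : value B b j [set j] gs mk A = valj gs (mk j) A.
Proof. by apply: eq_value => l; rewrite inE => /eqP->. Qed.

(** Each pair [(m, s)] has probability 1/4. The first two summands come from [m] being the opponent
    of [j], the conditional from [m = j]; a type without [j] changes nothing for [j]. *)
Lemma valj_step g gs l A :
  valj (g :: gs) l A =
  (1 - \sum_i rate g i) * valj gs l A +
  \sum_i rate g i / 4 *
    (valj gs l A + valj gs l (A + bid i) +
     (if large i then marked_sum gs l i A
      else valj gs l A + valj gs l (A + bid i))).
Proof.
rewrite {1}/valj /= sum_outcome.
set V := valj gs l A; set M := fun i => valj gs l A + valj gs l (A + bid i) +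
     (if large i then marked_sum gs l i A
      else valj gs l A + valj gs l (A + bid i)).
transitivity (V + \sum_i \sum_(e : {set J} | (#|e| == 2%N) && (j \in e))
    g i e * (M i / 4 - V)); last first.
  rewrite mulrBl mul1r -addrA; congr (_ + _).
  rewrite mulr_suml -sumrN -big_split/=; apply: eq_bigr => i _.
  by rewrite -mulr_suml -/(rate g i) /M /V; field.
rewrite value_valj /= -/V mulrBl mul1r -addrA; congr (_ + _).
rewrite mulr_suml -sumrN -big_split/=; apply: eq_bigr => i _.
rewrite mulr_suml -sumrN -big_split/= big_mkcondr/=; apply: eq_bigr => e.
move=> /cards2P[x [y [xy eE]]].
have [je|je] := boolP (j \in e); last first.
  suff -> : \sum_(m in e) \sum_(s in e)
     value B b j [set j] gs
       (mark B b (fun=> l) i m (selectK B b [set j] (fun=> l) i e m s))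
       (A + gain B b j i (selectK B b [set j] (fun=> l) i e m s)) = 4 * V.
    by field.
  rewrite (eq_bigr (fun=> 2 * V)); last first.
    move=> m me; rewrite (eq_bigr (fun=> V)); last first.
      move=> s se.
      have mj : m != j by apply: contraNneq je => <-.
      have -> : selectK B b [set j] (fun=> l) i e m s = s.
        by rewrite /selectK inE (negbTE mj) andbF.
      have sj : s != j by apply: contraNneq je => <-.
      by rewrite value_valj /gain (negbTE sj) addr0 /mark eq_sym (negbTE mj) andbF.
    by rewrite sumr_const eE cards2 xy /= mulr_natl.
  by rewrite sumr_const eE cards2 xy /=; ring.
have [k jk ->] : exists2 k, j != k & e = [set j; k].
  move: je; rewrite eE !inE => /orP[/eqP->|/eqP->]; first by exists y.
  by exists x; rewrite 1?eq_sym// setUC.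
rewrite !big_setU1 ?inE//= !big_set1 !big_setU1 ?inE//= !big_set1.
have selk (s : J) : selectK B b [set j] (fun=> l) i [set j; k] k s = s.
  by rewrite /selectK inE (eq_sym k) (negbTE jk) andbF.
have gk : gain B b j i k = 0 by rewrite /gain (eq_sym k) (negbTE jk).
have gj : gain B b j i j = bid i by rewrite /gain eqxx.
rewrite !selk !value_valj gk gj addr0.
have mark_k a : mark B b (fun=> l) i k a j = l.
  by rewrite /mark (negbTE jk) andbF.
rewrite !mark_k -/V.
suff -> : valj gs (mark B b (fun=> l) i j (selectK B b [set j] (fun=> l) i [set j; k] j j) j)
    (A + gain B b j i (selectK B b [set j] (fun=> l) i [set j; k] j j)) +
  valj gs (mark B b (fun=> l) i j (selectK B b [set j] (fun=> l) i [set j; k] j k) j)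
    (A + gain B b j i (selectK B b [set j] (fun=> l) i [set j; k] j k)) =
  if large i then marked_sum gs l i A else V + valj gs l (A + bid i).
  by rewrite /M -/V; case: ifP => _; field.
rewrite /selectK /mark inE eqxx !andbT.
case: ifP => big; last by rewrite gk gj addr0 addrC.
have kj : (k == j) = false by rewrite eq_sym (negbTE jk).
clear V M mark_k selk; case: l => [|x1 [|x2 l']] /=; rewrite ?big ?eqxx ?kj ?gk ?gj ?addr0 //.
by case: x1; rewrite ?other_pair// ?eqxx ?kj ?gk ?gj ?addr0; ring.
Qed.

Lemma rate_ge0 g i : feasible g -> 0 <= rate g i.
Proof. by move=> [g0 _]; apply: sumr_ge0 => e /andP[/g0]. Qed.

Lemma sum_rate_le1 g : feasible g -> \sum_i rate g i <= 1.
Proof.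
move=> [g0 g1]; apply: le_trans g1; apply: ler_sum => i _.
rewrite [leRHS](bigID (fun e : {set J} => j \in e))/= lerDl.
by apply: sumr_ge0 => e /andP[/g0].
Qed.

(* What matters about agent j: how many steps have been marked with it and, for
   a single one, whether it was selected there; and whether it already got an
   item with a large bid, in which case another one exhausts its budget. *)
Inductive phase := TwoMarks | SelMark | UnselMark | NoMark | FreshUnsel | Fresh.

Definition phase_of l : phase :=
  match l with
  | [::] => NoMark
  | [:: true] => SelMark
  | [:: false] => UnselMark
  | _ => TwoMarks
  end.

(** * Bounding the value by a potential *)

Section Potential.

(* [pot ph gs s] bounds the value of phase [ph] before the steps [gs] when a
   fraction [s] of the budget went to items with small bids; in the first four
   phases it is relative to the fraction left by the items with large bids. *)
Variable pot : phase -> seq (I -> {set J} -> R) -> R -> R.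

(** The mean change of the potential over the four pairs [(m, s)] at a large bid that leaves the
    fraction [c]. In the first four phases obtaining the item contributes zero; in the last two it
    leads to one of the first four, scaled by [c]. *)
Definition large_drift ph gs s c : R :=
  match ph with
  | TwoMarks => - (pot TwoMarks gs s / 2)
  | SelMark => pot TwoMarks gs s / 2 - 3 / 4 * pot SelMark gs s
  | UnselMark => - (3 / 4 * pot UnselMark gs s)
  | NoMark => pot UnselMark gs s / 4 - 3 / 4 * pot NoMark gs s
  | FreshUnsel => c * (pot UnselMark gs s / 4 + pot TwoMarks gs s / 2)
                  - 3 / 4 * pot FreshUnsel gs s
  | Fresh => pot FreshUnsel gs s / 4 + c * (pot NoMark gs s + pot SelMark gs s) / 4
             - 3 / 4 * pot Fresh gs s
  end.

Definition drift ph gs s i : R :=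
  if large i then large_drift ph gs s (1 - bid i)
  else (pot ph gs (s + bid i) - pot ph gs s) / 2.

Hypothesis pot_nil : forall ph s, 0 <= s -> Num.max (1 - s) 0 <= pot ph [::] s.
Hypothesis pot_step : forall ph g gs s, feasible g -> feasibles gs -> 0 <= s ->
  pot ph gs s + \sum_i rate g i * drift ph gs s i <= pot ph (g :: gs) s.

Lemma valj_step_le g gs l A (P : R) (D : I -> R) : feasible g ->
  valj gs l A <= P ->
  (forall i, valj gs l A + valj gs l (A + bid i) +
     (if large i then marked_sum gs l i A
      else valj gs l A + valj gs l (A + bid i)) <= 4 * (P + D i)) ->
  valj (g :: gs) l A <= P + \sum_i rate g i * D i.
Proof.
move=> fg VP VD; rewrite valj_step.
apply: (@le_trans _ _ ((1 - \sum_i rate g i) * P +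
    \sum_i rate g i / 4 * (4 * (P + D i)))).
  apply: lerD; first by apply: ler_wpM2l => //; rewrite subr_ge0 sum_rate_le1.
  by apply: ler_sum => i _; apply: ler_wpM2l => //; rewrite divr_ge0 ?rate_ge0.
rewrite mulrBl mul1r -addrA lerD2l mulr_suml -sumrN -big_split/=.
by apply: ler_sum => i _; lra.
Qed.

Lemma valj_out gs l A : feasibles gs -> 1 <= A -> valj gs l A = 0.
Proof. by move=> fgs A1; exact: value_spent_out. Qed.

(** Every further large item exhausts the budget, so its branch vanishes. Since
    [c - s <= c (1 - s)], the fraction [c] factors out of the effect of the small bids. *)
Lemma valj_large gs l s c A : feasibles gs -> 0 <= s -> 0 <= c <= 1 / 3 ->
  s + 1 - c <= A -> valj gs l A <= c * pot (phase_of l) gs s.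
Proof.
move=> + + c3; have /andP[c0 c13] := c3.
elim: gs l s A => [|g gs IH] l s A /= fgs s0 sA.
  apply: (@le_trans _ _ (c * Num.max (1 - s) 0)); last first.
    by apply: ler_wpM2l => //; exact: pot_nil.
  rewrite /valj /= ge_max; apply/andP; split; last first.
    by rewrite mulr_ge0// le_max lexx orbT.
  have : c * (1 - s) <= c * Num.max (1 - s) 0.
    by apply: ler_wpM2l => //; rewrite le_max lexx.
  have : c * s <= s by rewrite ler_piMl//; lra.
  lra.
case: fgs => fg fgs.
apply: (@le_trans _ _ (c * (pot (phase_of l) gs s +
    \sum_i rate g i * drift (phase_of l) gs s i))); last first.
  by apply: ler_wpM2l => //; exact: pot_step.
rewrite mulrDr mulr_sumr.
rewrite (eq_bigr (fun i => rate g i * (c * drift (phase_of l) gs s i))); last first.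
  by move=> i _; rewrite mulrCA.
apply: valj_step_le => //; first exact: IH.
move=> i; have b0 := rel_bid_ge0 j B_gt0 b_ge0 i.
have hV := IH l s A fgs s0 sA.
rewrite /drift; case: ifPn => [|_]; last first.
  have : valj gs l (A + bid i) <= c * pot (phase_of l) gs (s + bid i).
    by apply: IH => //; lra.
  lra.
rewrite largeE => b23.
have out l' : valj gs l' (A + bid i) = 0 by apply: valj_out => //; lra.
have hW := IH _ s A fgs s0 sA.
rewrite out addr0 /marked_sum; case: l hV => [|x [|x' l']] hV.
- by rewrite /= out; have /= := hW [:: false]; move: hV => /=; lra.
- case: x hV => hV; rewrite ?out ?addr0.
    by have /= := hW [:: true; false]; move: hV => /=; lra.
  by move: hV => /=; lra.
- rewrite out; have := hW (rcons [:: x, x' & l'] false); move: hV => /=.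
  by case: x => /=; lra.
Qed.

(** [Fresh] leads to [FreshUnsel], so both are treated together. No other phase lacks a large item:
    after an unselected mark the next mark selects [j], and [valj_large] takes over with
    [c = 1 - bid i]. *)
Lemma valj_fresh gs s A : feasibles gs -> 0 <= s -> s <= A ->
  valj gs [::] A <= pot Fresh gs s /\ valj gs [:: false] A <= pot FreshUnsel gs s.
Proof.
elim: gs s A => [|g gs IH] s A /= fgs s0 sA.
  have h : Num.max (1 - A) 0 <= Num.max (1 - s) 0.
    by rewrite ge_max !le_max lexx orbT andbT lerD2l lerN2 sA.
  by split; apply: (le_trans h); exact: pot_nil.
case: fgs => fg fgs; have [hF hU] := IH s A fgs s0 sA.
have hsel i l : large i ->
    valj gs l (A + bid i) <= (1 - bid i) * pot (phase_of l) gs s.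
  rewrite largeE => b23; apply: valj_large => //; last lra.
  by have := rel_bid_le1 i; lra.
have hsmall i := IH (s + bid i) (A + bid i) fgs.
split.
  apply: le_trans (pot_step _ fg fgs s0); apply: valj_step_le => // i.
  have b0 := rel_bid_ge0 j B_gt0 b_ge0 i.
  rewrite /drift; case: ifPn => [b23|_]; last first.
    have [||+ _] := hsmall i; lra.
  rewrite /marked_sum/=; have /= := hsel i [::] b23; have /= := hsel i [:: true] b23.
  lra.
apply: le_trans (pot_step _ fg fgs s0); apply: valj_step_le => // i.
have b0 := rel_bid_ge0 j B_gt0 b_ge0 i.
rewrite /drift; case: ifPn => [b23|_]; last first.
  have [||_ +] := hsmall i; lra.
rewrite /marked_sum/=; have /= := hsel i [:: false] b23.
have /= := hsel i [:: false; true] b23.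
lra.
Qed.

End Potential.

(** The half is the probability that a uniform choice selects [j]. [large_slack] is what the large
    load lacks to [large_mass] because bids may be below the full budget. *)
Definition large_mass g : R := \sum_(i | large i) rate g i / 2.
Definition large_slack g : R := \sum_(i | large i) rate g i / 2 * (1 - bid i).
Definition small_load g : R := \sum_(i | ~~ large i) rate g i / 2 * bid i.

Definition total_large gs : R := \sum_(g <- gs) (large_mass g - large_slack g).
Definition total_small gs : R := \sum_(g <- gs) small_load g.

Lemma step_loads g : feasible g ->
  [/\ 0 <= large_slack g, large_slack g <= large_mass g / 3,
      0 <= small_load g & large_mass g + small_load g <= 1 / 2].
Proof.
move=> fg; have r0 i := rate_ge0 i fg.
have b0 i := rel_bid_ge0 j B_gt0 b_ge0 i; have b1 := rel_bid_le1.
split.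
- by apply: sumr_ge0 => i _; rewrite mulr_ge0// ?divr_ge0// subr_ge0.
- rewrite mulr_suml; apply: ler_sum => i; rewrite largeE => b23.
  by apply: ler_wpM2l; [rewrite divr_ge0|lra].
- by apply: sumr_ge0 => i _; rewrite mulr_ge0// ?divr_ge0.
- apply: (@le_trans _ _ ((\sum_i rate g i) / 2)); last first.
    by have := sum_rate_le1 fg; lra.
  rewrite mulr_suml [leRHS](bigID (fun i => large i))/= lerD2l.
  by apply: ler_sum => i _; rewrite ler_piMr// divr_ge0.
Qed.

Lemma total_large_ge0 gs : feasibles gs -> 0 <= total_large gs.
Proof.
elim: gs => [|g gs IH] /=; first by rewrite /total_large big_nil.
move=> [fg /IH h]; rewrite /total_large big_cons addr_ge0//.
by have [] := step_loads fg; lra.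
Qed.

Lemma total_small_ge0 gs : feasibles gs -> 0 <= total_small gs.
Proof.
elim: gs => [|g gs IH] /=; first by rewrite /total_small big_nil.
move=> [fg /IH h]; rewrite /total_small big_cons addr_ge0//.
by have [] := step_loads fg.
Qed.

Lemma drift_sum_le pot ph g gs s (a c kappa : R) : feasible g ->
  (forall x, large_drift pot ph gs s x = a + x * c) ->
  (forall i, ~~ large i -> pot ph gs (s + bid i) - pot ph gs s <= bid i * kappa) ->
  \sum_i rate g i * drift pot ph gs s i <=
  2 * a * large_mass g + 2 * c * large_slack g + kappa * small_load g.
Proof.
move=> fg hL hS; have r0 i := rate_ge0 i fg.
rewrite (bigID (fun i => large i))/= /drift; apply: lerD.
  rewrite !mulr_sumr -big_split/=; apply: ler_sum => i ->; rewrite hL.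
  by rewrite le_eqVlt; apply/orP; left; apply/eqP; field.
rewrite mulr_sumr; apply: ler_sum => i il; rewrite (negbTE il).
have := ler_wpM2l (r0 i) (hS i il); lra.
Qed.

(** * The potential used for large load at most 8 *)

Section ModerateLargeLoad.

(** All phases have value 1 at 0. [TwoMarks], [UnselMark] and [NoMark] solve [V' = 2 large_drift];
    the last two phases mix in [e^-y] to pay for the budget left by large bids. In [FreshUnsel], 2/5
    is the least weight that survives large [y] when bids are 2/3. *)
Definition phase_pot ph (y : R) : R :=
  let e := expR (- y) in let e3 := expR (- (3 / 2 * y)) in
  match ph with
  | TwoMarks => e
  | SelMark => ter y
  | UnselMark => e3
  | NoMark => (1 + y / 2) * e3
  | FreshUnsel => 2 / 5 * e + 3 / 5 * e3
  | Fresh => 69 / 100 * e + 31 / 100 * ((1 + y / 2) * e3)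
  end.

Definition phase_pot' ph (y : R) : R :=
  let e := expR (- y) in let e3 := expR (- (3 / 2 * y)) in
  match ph with
  | TwoMarks => - e
  | SelMark => (3 / 2 + y) * expR (- y) ^+ 2 - 2 * expR (- y)
  | UnselMark => - (3 / 2 * e3)
  | NoMark => (1 / 2 - 3 / 2 * (1 + y / 2)) * e3
  | FreshUnsel => - (2 / 5 * e) - 9 / 10 * e3
  | Fresh => - (69 / 100 * e) + 31 / 100 * ((1 / 2 - 3 / 2 * (1 + y / 2)) * e3)
  end.

Lemma expRN32_step (y x c : R) : 0 <= y -> 0 <= x -> 0 <= c <= 1 ->
  (1 + c * (y / 2)) * expR (- (3 / 2 * y)) +
    x * ((c / 2 - 3 / 2 * (1 + c * (y / 2))) * expR (- (3 / 2 * y))) <=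
  (1 + c * ((y + x) / 2)) * expR (- (3 / 2 * (y + x))) /\
  (1 + c * ((y + x) / 2)) * expR (- (3 / 2 * (y + x))) <=
  (1 + c * (y / 2)) * expR (- (3 / 2 * y)).
Proof.
move=> y0 x0 /andP[c0 c1]; have e0 := expR_ge0 (- (3 / 2 * y)).
have cy0 : 0 <= c * y by exact: mulr_ge0.
have cb : 0 <= c <= 1 + c * (y / 2) by apply/andP; split; lra.
have := ler_wpM2l e0 (damp_ge cb x0 (lexx 0)).
have := ler_wpM2l e0 (damp_le cb x0 (lexx 0)).
have -> : - (3 / 2 * (y + x)) = - (3 / 2 * y) + - (3 / 2 * x + 0) by ring.
rewrite expRD; set E := expR (- (3 / 2 * y)); set F := expR (- _).
by move=> h1 h2; split; lra.
Qed.

Lemma phase_pot_step ph (y x : R) : 0 <= y -> 0 <= x ->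
  phase_pot ph y + x * phase_pot' ph y <= phase_pot ph (y + x) /\
  phase_pot ph (y + x) <= phase_pot ph y.
Proof.
move=> y0 x0.
have h0 : 0 <= (0 : R) <= 1 by rewrite lexx ler01.
have h1 : 0 <= (1 : R) <= 1 by rewrite lexx ler01.
have [u1 u2] := expRN32_step y0 x0 h0; have [a1 a2] := expRN32_step y0 x0 h1.
have w1 : expR (- y) - x * expR (- y) <= expR (- (y + x)).
  rewrite opprD expRD; have := expR_ge1Dx (- x).
  by move=> /(ler_wpM2l (expR_ge0 (- y))); lra.
have w2 : expR (- (y + x)) <= expR (- y) by rewrite ler_expR; lra.
have t1 := ter_convex y0 x0; have t2 := ter_le y0 x0.
by case: ph; rewrite /phase_pot /phase_pot'; split; lra.
Qed.

Lemma phase_pot_ge0 ph (y : R) : 0 <= y -> 0 <= phase_pot ph y.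
Proof.
move=> y0; have e0 := expR_ge0 (- y); have e30 := expR_ge0 (- (3 / 2 * y)).
have a0 : 0 <= (1 + y / 2) * expR (- (3 / 2 * y)) by rewrite mulr_ge0//; lra.
case: ph; rewrite /phase_pot //; try lra.
have p1 : (1 + y) * expR (- y) <= 1 by exact: expRN_mul1Dx_le1.
have yp : 0 <= y * expR (- y) by exact: mulr_ge0.
have : 0 <= expR (- y) * (2 - (1 + y / 2) * expR (- y)) by rewrite mulr_ge0//; lra.
rewrite /ter; lra.
Qed.

Definition phase_drift ph (y c : R) : R :=
  large_drift (fun ph _ _ => phase_pot ph y) ph [::] 0 c.

(** Both sides are linear in [(nu, dl)], so the extreme cases are [dl = 0] and [dl = nu / 3]. For
    [Fresh] the latter is [zero_state_rate] at [y / 2], times [k^2]. *)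
Lemma phase_drift_le ph (y nu dl : R) : 0 <= y -> 0 <= dl -> dl <= nu / 3 ->
  2 * phase_drift ph y 0 * nu + 2 * (phase_drift ph y 1 - phase_drift ph y 0) * dl <=
  (nu - dl) * phase_pot' ph y.
Proof.
move=> y0 dl0 dlnu; rewrite /phase_drift.
set k := expR (- (y / 2)).
have k0 : 0 <= k by exact: expR_ge0.
have k1 : k <= 1 by rewrite /k expR_le1; lra.
have eE : expR (- y) = k ^+ 2.
  have -> : - y = - (y / 2) + - (y / 2) by field.
  by rewrite expRD -expr2.
have e3E : expR (- (3 / 2 * y)) = k ^+ 3.
  have -> : - (3 / 2 * y) = - (y / 2) + - (y / 2) + - (y / 2) by field.
  by rewrite !expRD -/k; ring.
have k20 : 0 <= k ^+ 2 by exact: exprn_ge0.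
have k30 : 0 <= k ^+ 3 by exact: exprn_ge0.
have k40 : 0 <= k ^+ 4 by exact: exprn_ge0.
have k32 : k ^+ 3 <= k ^+ 2 by rewrite [k ^+ 3]exprSr ler_piMr.
have yk2 : 0 <= y * k ^+ 2 by exact: mulr_ge0.
have yk3 : 0 <= y * k ^+ 3 by exact: mulr_ge0.
have yk4 : 0 <= y * k ^+ 4 by exact: mulr_ge0.
have nud : 0 <= nu - 3 * dl by lra.
have k2d := mulr_ge0 k20 dl0; have k3d := mulr_ge0 k30 dl0.
have yk3d := mulr_ge0 yk3 dl0.
have k2n := mulr_ge0 k20 nud; have k3n := mulr_ge0 k30 nud.
have p1 : (1 + y) * k ^+ 2 <= 1 by rewrite -eE; exact: expRN_mul1Dx_le1.
case: ph; rewrite /= /ter ?eE ?e3E.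
- lra.
- have h : 0 <= (2 - (3 / 2 + y) * k ^+ 2) * (k ^+ 2 * dl).
    by rewrite mulr_ge0//; lra.
  have : 0 <= y * k ^+ 4 * nu by rewrite mulr_ge0//; lra.
  lra.
- lra.
- lra.
- have : 0 <= (k ^+ 2 - k ^+ 3) * (nu - 3 * dl) by rewrite mulr_ge0// subr_ge0.
  lra.
- have : 0 <= (k ^+ 2 - k ^+ 3) * (nu - 3 * dl) by rewrite mulr_ge0// subr_ge0.
  have u0 : 0 <= y / 2 by lra.
  have := zero_state_rate u0; rewrite -/k.
  by move=> /(ler_wpM2r k2d); lra.
Qed.

(** At [s = 0] this is the expected fraction left when bids of 2/3 arrive as a Poisson process of
    load [z]: no arrival leaves 1, a single one leaves 1/3. *)
Definition small_pot (z s : R) : R :=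
  (Num.max (1 - s) 0 + Num.max (1 - 3 / 2 * s) 0 * (z / 2)) * expR (- (3 / 2 * z)).

Definition small_pot' (z s : R) : R :=
  (Num.max (1 - 3 / 2 * s) 0 / 2 -
   3 / 2 * (Num.max (1 - s) 0 + Num.max (1 - 3 / 2 * s) 0 * (z / 2))) *
  expR (- (3 / 2 * z)).

Lemma small_pot_ge0 (z s : R) : 0 <= z -> 0 <= small_pot z s.
Proof.
move=> z0; rewrite mulr_ge0 ?expR_ge0// addr_ge0// ?mulr_ge0//.
- by rewrite le_max lexx orbT.
- by rewrite le_max lexx orbT.
- lra.
Qed.

Lemma small_pot_step (z x s : R) : 0 <= z -> 0 <= x -> 0 <= s ->
  small_pot z s + x * small_pot' z s <= small_pot (z + x) s /\
  small_pot (z + x) s <= small_pot z s.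
Proof.
move=> z0 x0 s0; rewrite /small_pot /small_pot'.
set al : R := Num.max (1 - s) 0; set be : R := Num.max (1 - 3 / 2 * s) 0.
have be0 : 0 <= be by rewrite /be le_max lexx orbT.
have beal : be <= al.
  by rewrite /be /al ge_max !le_max lexx orbT andbT; apply/orP; left; lra.
have bz := mulr_ge0 be0 z0.
have cb : 0 <= be <= al + be * (z / 2) by apply/andP; split; lra.
have e0 := expR_ge0 (- (3 / 2 * z)).
have := ler_wpM2l e0 (damp_ge cb x0 (lexx 0)).
have := ler_wpM2l e0 (damp_le cb x0 (lexx 0)).
have -> : - (3 / 2 * (z + x)) = - (3 / 2 * z) + - (3 / 2 * x + 0) by ring.
rewrite expRD; set E := expR (- (3 / 2 * z)); set F := expR (- _).
by move=> h1 h2; split; lra.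
Qed.

(** The left side is convex in [x] and vanishes at 0, so [x = 2/3] decides; there the claim is
    [(1/3 - s)^+ <= (1 - 3s/2)^+ / 3]. *)
Lemma small_pot_bid (z s x : R) : 0 <= z -> 0 <= s -> 0 <= x <= 2 / 3 ->
  small_pot z (s + x) - small_pot z s <= x * small_pot' z s.
Proof.
move=> z0 s0 /andP[x0 x1]; rewrite /small_pot /small_pot'.
have e0 := expR_ge0 (- (3 / 2 * z)).
set al : R := Num.max (1 - s) 0; set be : R := Num.max (1 - 3 / 2 * s) 0.
set al' : R := Num.max (1 - (s + x)) 0; set be' : R := Num.max (1 - 3 / 2 * (s + x)) 0.
have sx : 0 <= s * x by exact: mulr_ge0.
have h1 : be' <= be * (1 - 3 / 2 * x).
  rewrite /be /be' /Order.max; do 2 case: ltP => ?; nra.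
have h2 : al' <= al * (1 - 3 / 2 * x) + x / 2 * be.
  rewrite /al /al' /be /Order.max; do 3 case: ltP => ?; nra.
have h3 := ler_wpM2l z0 h1.
suff h : 0 <= (al * (1 - 3 / 2 * x) + x / 2 * be - al' +
      (z * (be * (1 - 3 / 2 * x)) - z * be') / 2) * expR (- (3 / 2 * z)) by lra.
by rewrite mulr_ge0//; lra.
Qed.

Definition moderate_pot ph gs s : R :=
  phase_pot ph (total_large gs) * small_pot (total_small gs) s.

Lemma small_bid_range i : ~~ large i -> 0 <= bid i <= 2 / 3.
Proof.
rewrite largeE -ltNge => /ltW ->; rewrite andbT.
exact: rel_bid_ge0 j B_gt0 b_ge0 i.
Qed.

Lemma moderate_pot_nil ph s : 0 <= s -> Num.max (1 - s) 0 <= moderate_pot ph [::] s.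
Proof.
move=> s0; rewrite /moderate_pot /total_large /total_small !big_nil /small_pot.
have -> : phase_pot ph 0 = 1.
  by case: ph; rewrite /phase_pot /ter ?mulr0 oppr0 expR0; field.
by rewrite mul0r !mulr0 oppr0 expR0 addr0 mul1r mulr1.
Qed.

Lemma moderate_pot_step ph g gs s : feasible g -> feasibles gs -> 0 <= s ->
  moderate_pot ph gs s + \sum_i rate g i * drift moderate_pot ph gs s i <=
  moderate_pot ph (g :: gs) s.
Proof.
move=> fg fgs s0; have [d0 dnu z0 _] := step_loads fg.
have Y0 := total_large_ge0 fgs; have Z0 := total_small_ge0 fgs.
rewrite {3}/moderate_pot /total_large /total_small !big_cons.
rewrite -/(total_large gs) -/(total_small gs).
rewrite [_ + total_large gs]addrC [_ + total_small gs]addrC.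
set y := total_large gs in Y0 *; set z := total_small gs in Z0 *.
set nu := large_mass g in dnu *; set dl := large_slack g in d0 dnu *.
set w := small_load g in z0 *.
have y0 : 0 <= nu - dl by lra.
have hd := phase_drift_le ph Y0 d0 dnu.
set a := phase_drift ph y 0 in hd; set c := phase_drift ph y 1 in hd.
have [v1 v2] := phase_pot_step ph Y0 y0.
have [s1 s2] := small_pot_step Z0 z0 s0.
have S0 := small_pot_ge0 s Z0; have V0 := phase_pot_ge0 ph Y0.
apply: le_trans (_ : moderate_pot ph gs s + (2 * (a * small_pot z s) * nu +
    2 * ((c - a) * small_pot z s) * dl + phase_pot ph y * small_pot' z s * w) <= _).
  rewrite lerD2l; apply: drift_sum_le => // [x|i il].
    by rewrite /a /c; clear; case: ph => /=; rewrite /phase_drift /=;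
      rewrite /moderate_pot /y /z /phase_pot; field.
  have := small_pot_bid Z0 s0 (small_bid_range il).
  by move=> /(ler_wpM2l V0); rewrite /moderate_pot -/y -/z; lra.
rewrite /moderate_pot -/y -/z.
have q1 := ler_wpM2r S0 (le_trans (lerD (lexx _) hd) v1).
have q2 := ler_wpM2l V0 s1.
(* Both factors decrease, so the product of their increments is nonnegative. *)
have q3 : 0 <= (phase_pot ph y - phase_pot ph (y + (nu - dl))) *
    (small_pot z s - small_pot (z + w) s) by rewrite mulr_ge0 ?subr_ge0.
lra.
Qed.

End ModerateLargeLoad.

(** * The potential used for large load at least 8 *)

Section HeavyLargeLoad.

(** A product over the steps rather than an exponential of the load: [large_mass] exceeds the large
    load by [large_slack], and [one_large_survival] exploits this. *)
Fixpoint survival gs : R :=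
  if gs is g :: gs' then (1 - large_mass g - small_load g) * survival gs' else 1.

Fixpoint one_large gs : R :=
  if gs is g :: gs' then
    (1 - large_mass g - small_load g) * one_large gs' + large_slack g * survival gs'
  else 0.

Definition damping gs : R := expR (- (3 / 2 * total_large gs + total_small gs)).

(** In the last two phases [one_large] stands for obtaining exactly one large item, weighted by the
    fraction it leaves. The factor 2 in [SelMark] balances half of [TwoMarks] against three quarters
    of [SelMark]. *)
Definition heavy_phase ph gs : R :=
  match ph with
  | TwoMarks => survival gs
  | SelMark => 2 * survival gs
  | UnselMark => damping gs
  | NoMark => (1 + total_large gs / 2) * damping gs
  | FreshUnsel => one_large gs + damping gs
  | Fresh => one_large gs + (1 + total_large gs / 2) * damping gs
  end.

Lemma survival_ge0 gs : feasibles gs -> 0 <= survival gs.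
Proof.
elim: gs => [//|g gs IH] /= [fg /IH h]; rewrite mulr_ge0//.
by have [] := step_loads fg; lra.
Qed.

Lemma one_large_ge0 gs : feasibles gs -> 0 <= one_large gs.
Proof.
elim: gs => [//|g gs IH] /= [fg fgs]; have := IH fgs; have := survival_ge0 fgs.
by have [] := step_loads fg => *; rewrite addr_ge0 ?mulr_ge0//; lra.
Qed.

Definition heavy_drift ph gs c : R :=
  large_drift (fun ph gs _ => heavy_phase ph gs) ph gs 0 c.

(** The terms in [survival] and [one_large] follow from their recurrences, those in [damping] from
    [damp_ge], whose rate [3/2 (nu - dl)] leaves room for the contributions in [dl]. *)
Lemma heavy_phase_step ph g gs : feasible g -> feasibles gs ->
  heavy_phase ph gs * (1 - small_load g) +
    2 * heavy_drift ph gs 0 * large_mass g +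
    2 * (heavy_drift ph gs 1 - heavy_drift ph gs 0) * large_slack g <=
  heavy_phase ph (g :: gs).
Proof.
move=> fg fgs; have [d0 dnu z0 _] := step_loads fg.
have Y0 := total_large_ge0 fgs.
have P0 := survival_ge0 fgs; have D0 := one_large_ge0 fgs.
have EE : damping (g :: gs) = damping gs *
    expR (- (3 / 2 * (large_mass g - large_slack g) + small_load g)).
  by rewrite -expRD /damping /total_large /total_small !big_cons; congr expR; ring.
have E0 : 0 <= damping gs by exact: expR_ge0.
have YE : total_large (g :: gs) = total_large gs + (large_mass g - large_slack g).
  by rewrite /total_large big_cons addrC.
set nu := large_mass g in d0 dnu EE YE *; set dl := large_slack g in d0 dnu EE YE *.
set z := small_load g in z0 EE *; set y := total_large gs in Y0 YE *.
have x0 : 0 <= nu - dl by lra.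
have cb : 0 <= (1 : R) <= 1 + y / 2 by apply/andP; split; lra.
have c0 : 0 <= (0 : R) <= 1 by rewrite lexx ler01.
have hA := ler_wpM2l E0 (damp_ge cb x0 z0).
have hE := ler_wpM2l E0 (damp_ge c0 x0 z0).
have yE := mulr_ge0 Y0 E0.
have dE := mulr_ge0 d0 E0; have dyE := mulr_ge0 d0 yE.
have nu0 : 0 <= nu by lra.
have nD := mulr_ge0 nu0 D0.
case: ph; rewrite /heavy_drift /= ?EE ?YE -/nu -/dl -/z -/y; lra.
Qed.

Definition heavy_pot ph gs s : R := heavy_phase ph gs * Num.max (1 - s) 0.

Lemma heavy_phase_ge0 ph gs : feasibles gs -> 0 <= heavy_phase ph gs.
Proof.
move=> fgs; have P0 := survival_ge0 fgs; have D0 := one_large_ge0 fgs.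
have Y0 := total_large_ge0 fgs.
have E0 : 0 <= damping gs by exact: expR_ge0.
have A0 : 0 <= (1 + total_large gs / 2) * damping gs by rewrite mulr_ge0//; lra.
by case: ph => /=; lra.
Qed.

Lemma heavy_pot_nil ph s : 0 <= s -> Num.max (1 - s) 0 <= heavy_pot ph [::] s.
Proof.
move=> s0; rewrite ler_peMl// ?le_max ?lexx ?orbT//.
have EE : damping [::] = 1.
  by rewrite /damping /total_large /total_small !big_nil mulr0 addr0 oppr0 expR0.
by case: ph; rewrite /= ?EE /total_large ?big_nil; lra.
Qed.

Lemma heavy_pot_step ph g gs s : feasible g -> feasibles gs -> 0 <= s ->
  heavy_pot ph gs s + \sum_i rate g i * drift heavy_pot ph gs s i <=
  heavy_pot ph (g :: gs) s.
Proof.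
move=> fg fgs s0; have V0 := heavy_phase_ge0 ph fgs.
set al : R := Num.max (1 - s) 0.
have al0 : 0 <= al by rewrite /al le_max lexx orbT.
apply: le_trans (_ : heavy_pot ph gs s + (2 * (heavy_drift ph gs 0 * al) * large_mass g +
    2 * ((heavy_drift ph gs 1 - heavy_drift ph gs 0) * al) * large_slack g +
    - (heavy_phase ph gs * al) * small_load g) <= _).
  rewrite lerD2l; apply: drift_sum_le => // [x|i il].
    by clear; case: ph => /=; rewrite /heavy_drift /heavy_pot /al /= /heavy_phase; field.
  have b0 := rel_bid_ge0 j B_gt0 b_ge0 i; have b1 := rel_bid_le1 i.
  have h : Num.max (1 - (s + bid i)) 0 - al <= - (bid i * al).
    have := mulr_ge0 s0 b0.
    by rewrite /al /Order.max; do 2 case: ltP => ?; nra.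
  by have := ler_wpM2l V0 h; rewrite /heavy_pot -/al; lra.
rewrite /heavy_pot -/al; have := ler_wpM2r al0 (heavy_phase_step ph fg fgs); lra.
Qed.

(* [X] is the sum of [dl / (1 - nu - z)] over the steps; each term is at most
   1/3 and [e^(nu - dl + z) (1 - nu - z) (1 + dl / (1 - nu - z)) <= 1]. *)
Lemma one_large_survival gs : feasibles gs -> exists X : R,
  [/\ 0 <= X, one_large gs = survival gs * X &
      expR (total_large gs + total_small gs) * survival gs *
        (1 + 4 / 5 * X + X ^+ 2 / 2) <= 1].
Proof.
elim: gs => [|g gs IH] /=.
  move=> _; exists 0; split => //; first by rewrite mulr0.
  by rewrite /total_large /total_small !big_nil addr0 expR0 mulr0 expr0n/=; lra.
move=> [fg fgs]; have [X [X0 DE hX]] := IH fgs.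
have [d0 dnu z0 nuz] := step_loads fg; have P0 := survival_ge0 fgs.
rewrite /total_large /total_small !big_cons -/(total_large gs) -/(total_small gs).
set nu := large_mass g in d0 dnu nuz *; set dl := large_slack g in d0 dnu *.
set z := small_load g in z0 nuz *.
set q := 1 - nu - z; have q2 : 1 / 2 <= q by rewrite /q; lra.
have q0 : 0 < q by lra.
pose x := dl / q.
have x0 : 0 <= x by rewrite divr_ge0//; lra.
have x3 : x <= 1 / 3 by rewrite ler_pdivrMr//; lra.
have dE : dl = q * x by rewrite /x; field; exact: lt0r_neq0.
exists (X + x); split; first exact: addr_ge0.
  by rewrite DE dE; ring.
have -> : nu - dl + total_large gs + (z + total_small gs) =
    (nu - dl + z) + (total_large gs + total_small gs) by ring.
rewrite expRD; set F := expR (nu - dl + z); set G := expR (total_large gs + _) in hX *.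
have F1 : F * (q * (1 + x)) <= 1.
  have -> : q * (1 + x) = 1 - (nu - dl + z) by rewrite mulrDr mulr1 -dE /q; ring.
  have := expR_ge1Dx (- (nu - dl + z)).
  move=> /(ler_wpM2l (expR_ge0 (nu - dl + z))).
  by rewrite expRxMexpNx_1 -/F.
(* The gap is [x (1/5 - X/5 + X^2/2 - x/2)], nonnegative as [x <= 1/3]; a linear coefficient 1
   instead of 4/5 would fail at [X = 0]. *)
have poly : 1 + 4 / 5 * (X + x) + (X + x) ^+ 2 / 2 <=
    (1 + x) * (1 + 4 / 5 * X + X ^+ 2 / 2).
  have : 0 <= x * (1 / 3 - x) by rewrite mulr_ge0//; lra.
  have : 0 <= x * (X - 1 / 5) ^+ 2 by rewrite mulr_ge0 ?sqr_ge0.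
  by lra.
have F0 : 0 <= F by exact: expR_ge0.
have G0 : 0 <= G by exact: expR_ge0.
apply: (@le_trans _ _ (F * G * (q * survival gs) *
    ((1 + x) * (1 + 4 / 5 * X + X ^+ 2 / 2)))).
  by apply: ler_wpM2l => //; rewrite !mulr_ge0//; lra.
have -> : F * G * (q * survival gs) * ((1 + x) * (1 + 4 / 5 * X + X ^+ 2 / 2)) =
  F * (q * (1 + x)) * (G * survival gs * (1 + 4 / 5 * X + X ^+ 2 / 2)) by ring.
apply: mulr_ile1 => //; first by rewrite !mulr_ge0//; lra.
by rewrite !mulr_ge0 ?addr_ge0 ?mulr_ge0 ?sqr_ge0//; lra.
Qed.

(** Of the factor 9/16, 46/100 pays for [one_large] and 1/10 for the [damping] term, as
    [5 e^-4 <= 1/10]. *)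
Lemma heavy_bound gs : feasibles gs -> 8 <= total_large gs ->
  heavy_phase Fresh gs <= expR (- (total_large gs + total_small gs)) * (9 / 16).
Proof.
move=> fgs y8 /=; have [X [X0 DE hX]] := one_large_survival fgs.
have P0 := survival_ge0 fgs.
set y := total_large gs in y8 hX *; set z := total_small gs in hX *.
have h1 : one_large gs <= expR (- (y + z)) * (46 / 100).
  rewrite expRN mulrC ler_pdivlMr ?expR_gt0// DE.
  have e0 := expR_ge0 (y + z).
  have eP := mulr_ge0 e0 P0.
  (* [X / (1 + 4X/5 + X^2/2)] peaks at the square root of 2, close to 7/5, with value about
     0.452. *)
  have : X <= 46 / 100 * (1 + 4 / 5 * X + X ^+ 2 / 2).
    by have : 0 <= (X - 7 / 5) ^+ 2 by [exact: sqr_ge0]; lra.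
  move=> /(ler_wpM2l eP); lra.
have h2 : (1 + y / 2) * damping gs <= expR (- (y + z)) * (1 / 10).
  have -> : damping gs = expR (- (y + z)) * expR (- (y / 2)).
    by rewrite /damping -expRD; congr expR; rewrite -/y -/z; field.
  rewrite mulrCA; apply: ler_wpM2l; first exact: expR_ge0.
  have v0 : 0 <= y / 2 - 4 by lra.
  have f0 : 0 <= 4 :> R by [].
  have := gamma_decr f0 v0.
  have -> : 4 + (y / 2 - 4) = y / 2 by ring.
  have -> : 1 + 4 + (y / 2 - 4) = 1 + y / 2 by ring.
  have := expRN4_le R; lra.
have := expR_ge0 (- (y + z)); lra.
Qed.

End HeavyLargeLoad.

(** * From the load to the final bound *)

Lemma total_loadE T (f : 'I_T -> I -> {set J} -> R) :
  load B b f j = total_large [seq f t | t <- enum 'I_T] +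
                 total_small [seq f t | t <- enum 'I_T].
Proof.
rewrite /total_large /total_small -big_split/= big_map big_enum/=.
apply: eq_bigr => t _; set g := f t.
rewrite /large_mass /large_slack /small_load -sumrB.
rewrite [X in _ = X + _](eq_bigr (fun i => rate g i / 2 * bid i)); last first.
  by move=> i _; rewrite mulrBr mulr1 subKr.
rewrite -(bigID (fun i => large i) predT (fun i => rate g i / 2 * bid i))/=.
apply: eq_bigr => i _; rewrite -mulr_suml; congr (_ * _).
rewrite -mulr_sumr mulrC; congr (_ / _); rewrite /rate.
(* The surrogate pairs containing [j] correspond to the opponents [k != j]. *)
rewrite [RHS](reindex_onto (fun k => [set j; k]) (fun e => other e j))/=; last first.
  move=> e /andP[/cards2P[x [y [xy ->]]]]; rewrite !inE => /orP[/eqP->|/eqP->].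
    by rewrite other_pair.
  by rewrite (setUC [set x]) other_pair// eq_sym.
apply: eq_bigl => k; rewrite !inE eqxx andbT cards2.
have [->|kj] := eqVneq k j; first by rewrite ?eqxx.
by rewrite /= other_pair ?eqxx// eq_sym.
Qed.

Lemma valj_bound gs x : feasibles gs -> x = total_large gs + total_small gs ->
  valj gs [::] 0 <=
    expR (- x) * (3 / 4 + 1 / 4 * ((1 + x / 4) / expR (x / 4))) ^+ 2.
Proof.
move=> fgs ->.
have Y0 := total_large_ge0 fgs; have Z0 := total_small_ge0 fgs.
have [y8|y8] := lerP (total_large gs) 8.
  have [h _] := valj_fresh moderate_pot_nil moderate_pot_step fgs (lexx 0) (lexx 0).
  apply: (le_trans h); rewrite /moderate_pot /= /small_pot.
  have -> : Num.max (1 - 0) 0 = 1 :> R by rewrite subr0 max_l.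
  have -> : Num.max (1 - 3 / 2 * 0) 0 = 1 :> R by rewrite mulr0 subr0 max_l.
  set y := total_large gs in Y0 y8 *; set z := total_small gs in Z0 *.
  have y08 : 0 <= y <= 8 by rewrite Y0.
  have := ler_wpM2l (expR_ge0 (- (y + z))) (moderate_large_load y08 Z0).
  apply: le_trans.
  have -> : - (3 / 2 * y) = - y + - (y / 2) by field.
  have -> : - (3 / 2 * z) = - z + - (z / 2) by field.
  by rewrite opprD !expRD le_eqVlt; apply/orP; left; apply/eqP; ring.
have [h _] := valj_fresh heavy_pot_nil heavy_pot_step fgs (lexx 0) (lexx 0).
apply: (le_trans h); rewrite /heavy_pot subr0 max_l// mulr1.
apply: (le_trans (heavy_bound fgs (ltW y8))).
apply: ler_wpM2l; first exact: expR_ge0.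
have -> : 9 / 16 = (3 / 4) ^+ 2 :> R by field.
have : 0 <= (1 + (total_large gs + total_small gs) / 4) /
    expR ((total_large gs + total_small gs) / 4).
  by rewrite divr_ge0 ?expR_ge0//; lra.
by move=> ?; apply: lerXn2r; rewrite ?nnegrE; lra.
Qed.

End SingleAgent.

Theorem theorem5p1 (R : realType) (I J : finType) (T : nat)
    (B : J -> R) (b : I -> J -> R) (f : 'I_T -> I -> {set J} -> R)
    (B_gt0 : forall j, 0 < B j)
    (b_ge0 : forall i j, 0 <= b i j)
    (b_leB : forall i j, b i j <= B j)
    (f_ge0 : forall t i (e : {set J}), #|e| == 2%N -> 0 <= f t i e)
    (f_sum : forall t, \sum_i \sum_(e : {set J} | #|e| == 2%N) f t i e <= 1)
    (j : J) :
  let y := load B b f j in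
  is_true (expectation f (fun w => Num.max (1 - spent B b j w / B j) 0)
    <= expR (- y) * (3 / 4 + 1 / 4 * ((1 + y / 4) / expR (y / 4))) ^+ 2).
Proof.
have fgs : feasibles [seq f t | t <- enum 'I_T].
  by elim: (enum 'I_T) => //= t ts IH; split=> //; split; [exact: f_ge0|exact: f_sum].
rewrite /= expectation_value.
apply: le_trans (value_decorrelate _ _ _ _ fgs) _ => //.
by apply: valj_bound => //; exact: total_loadE.
Qed.
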